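(* Let $Q$ be a finite non-empty graded poset of rank $r$ with $|Q|=d$. Let $e(Q)$ denote the number of linear extensions of $Q$ and $\Omega(Q,k)$ its order polynomial. Then $$(r+2)^d\,e(Q)=\sum_{m=0}^{n}(-1)^{n+m}\left(\binom{d}{n-m}+(-1)^{d-1}\binom{d}{n+m+1}\right)\Omega(Q,m(r+2)+1),$$ where $n:=\lfloor d/2\rfloor$.
   Context: $C_k$ denotes the chain with $k$ elements. $\Omega(Q,k)$ is the order polynomial of $Q$: for positive integers $k$ it is the number of order-preserving maps $f:Q\to C_k$ (i.e. $x\le y$ implies $f(x)\le f(y)$). A linear extension of $Q$ is a bijective order-preserving map $Q\to C_d$. The poset $Q$ is graded of rank $r$ if all maximal chains of $Q$ have the same length $r$, where the length of a chain is its number of elements minus one. *)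

(* Defs.v *)
From mathcomp Require Import all_boot all_order all_algebra.

Set Implicit Arguments.
Unset Strict Implicit.
Unset Printing Implicit Defensive.

Local Open Scope order_scope.

(* The chain C_k with k elements is the ordinal type 'I_k in its natural
   (library) order. *)

Definition order_preserving (disp : Order.disp_t) (Q : finPOrderType disp)
    (k : nat) (f : {ffun Q -> 'I_k}) : bool :=
  [forall x : Q, forall y : Q, (x <= y) ==> (f x <= f y)].

(* Values of the order polynomial Omega(Q, k) at integers k > 0; the value of
   this function at k = 0 is not meant to be that of the polynomial. *)
Definition order_polynomial (disp : Order.disp_t) (Q : finPOrderType disp)
    (k : nat) : nat :=
  #|[set f : {ffun Q -> 'I_k} | order_preserving f]|.

Definition linear_extensions (disp : Order.disp_t) (Q : finPOrderType disp) :
    {set {ffun Q -> 'I_#|Q|}} :=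
  [set f : {ffun Q -> 'I_#|Q|} |
    [&& injectiveb f, [forall i, exists x, f x == i] & order_preserving f]].

Definition num_linear_extensions (disp : Order.disp_t)
    (Q : finPOrderType disp) : nat :=
  #|linear_extensions Q|.

Definition is_chain (disp : Order.disp_t) (Q : finPOrderType disp)
    (A : {set Q}) : bool :=
  [forall x in A, forall y in A, x >=< y].

(* Truncated predecessor: only meaningful for nonempty chains, hence for the
   maximal chains of a nonempty poset. *)
Definition chain_length (disp : Order.disp_t) (Q : finPOrderType disp)
    (A : {set Q}) : nat :=
  #|A|.-1.

Definition graded_of_rank (disp : Order.disp_t) (Q : finPOrderType disp)
    (r : nat) : Prop :=
  forall A : {set Q}, maxset (@is_chain disp Q) A -> chain_length A = r.

(* Main.v *)
(** Let [Z] be the zeta matrix of the order "[J] is a down-set of [I]" on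
    subsets of [Q], let [M] be its inverse and [d = #|Q|].  Reading a map
    [Q -> C_k] as the chain of its sublevel sets, the entry of [Z ^+ k] at
    [(Q, set0)] is [Omega(Q, k)], that of [M ^+ k] is [(-1) ^+ d] times the
    number of strict order-preserving maps, and that of [(Z - 1) ^+ d] is
    [e(Q)], while [(Z - 1) ^+ d.+1 = 0].  Hence, with [s = r + 2] and
    [n = d./2],
      [M ^+ ((d - n) * s) * (Z ^+ s - 1) ^+ d * Z = (Z - 1) ^+ d *+ s ^ d],
    whose binomial expansion is the formula: the terms with a negative exponent
    are folded onto the others because, for [Q] graded of rank [r], adding the
    rank function turns order-preserving maps to [C_k] into strict ones to
    [C_(k + r)]. *)
Require Import Defs.
From mathcomp Require Import all_boot all_order all_algebra.
From mathcomp Require Import zify ring.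

Set Implicit Arguments.
Unset Strict Implicit.
Unset Printing Implicit Defensive.

Import Order.TTheory GRing.Theory.

Local Open Scope ring_scope.

(** * Powers of a unipotent ring element and its left inverse *)

(** Put [N = Z - 1]. As [N ^+ d.+1 = 0], multiplying [N ^+ d] by [Z] on the right or by [M] on the
    left leaves it fixed. Hence the geometric sum in the factorisation of [Z ^+ s - 1] by [N] acts
    on [N ^+ d] as the scalar [s], once for each of the [d] factors. *)
Lemma mul_finite_difference (R : pzRingType) (Z M : R) (a s d : nat) :
  M * Z = 1 -> (Z - 1) ^+ d.+1 = 0 ->
  M ^+ a * (Z ^+ s - 1) ^+ d * Z = (Z - 1) ^+ d *+ (s ^ d)%N.
Proof.
move=> MZ N0; set N := Z - 1.
have NZ : N ^+ d * Z = N ^+ d.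
  by rewrite -[in LHS](subrK 1 Z) mulrDr mulr1 -exprSr N0 add0r.
have MN : M * N ^+ d = N ^+ d.
  have -> : M = 1 - M * N by rewrite mulrBr MZ mulr1 opprB addrC subrK.
  by rewrite mulrBl mul1r -mulrA -exprS N0 mulr0 subr0.
have NZk k : N ^+ d * Z ^+ k = N ^+ d.
  by elim: k => [|k IH]; rewrite ?mulr1 // exprS mulrA NZ.
have MNk k : M ^+ k * N ^+ d = N ^+ d.
  by elim: k => [|k IH]; rewrite ?mul1r // exprSr -mulrA MN.
have NS : N ^+ d * (\sum_(i < s) Z ^+ i) = N ^+ d *+ s.
  rewrite mulr_sumr (eq_bigr (fun=> N ^+ d)) => [|i _]; last exact: NZk.
  by rewrite sumr_const card_ord.
have cNS : GRing.comm N (\sum_(i < s) Z ^+ i).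
  apply: commr_sum => i _; apply: commrX; apply: commr_sym.
  by apply: commrD; [exact: commr_refl|apply: commrN; exact: commr1].
rewrite subrX1 exprMn_comm //.
have -> k : N ^+ d * (\sum_(i < s) Z ^+ i) ^+ k = N ^+ d *+ (s ^ k).
  elim: k => [|k IH]; first by rewrite mulr1 expn0 mulr1n.
  by rewrite exprS mulrA NS mulrnAl IH -mulrnA expnSr.
by rewrite mulrnAr MNk mulrnAl NZ.
Qed.

(** * Integer matrices indexed by a finite type *)

Definition kernel_mx (T : finType) (F : T -> T -> int) : 'M[int]_#|T| :=
  \matrix_(i, j) F (enum_val i) (enum_val j).

Definition entry (T : finType) (A : 'M[int]_#|T|) (x y : T) : int :=
  A (enum_rank x) (enum_rank y).

Lemma entry_inj (T : finType) (A B : 'M[int]_#|T|) : entry A =2 entry B -> A = B.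
Proof.
move=> AB; apply/matrixP => i j.
by move: (AB (enum_val i) (enum_val j)); rewrite /entry !enum_valK.
Qed.

Lemma entry_kernel (T : finType) (F : T -> T -> int) : entry (kernel_mx F) =2 F.
Proof. by move=> x y; rewrite /entry mxE !enum_rankK. Qed.

Lemma entry1 (T : finType) (x y : T) : entry 1 x y = (x == y)%:R.
Proof. by rewrite /entry mxE (inj_eq enum_rank_inj). Qed.

Lemma entryM (T : finType) (A B : 'M[int]_#|T|) x y :
  entry (A * B) x y = \sum_z entry A x z * entry B z y.
Proof.
rewrite /entry mxE (reindex (@enum_rank T)) //.
by exists enum_val => z _; rewrite ?enum_rankK ?enum_valK.
Qed.

Lemma entryB (T : finType) (A B : 'M[int]_#|T|) x y :
  entry (A - B) x y = entry A x y - entry B x y.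
Proof. by rewrite /entry !mxE. Qed.

Lemma entryMn (T : finType) (A : 'M[int]_#|T|) n x y :
  entry (A *+ n) x y = entry A x y *+ n.
Proof. by rewrite /entry mulmxnE. Qed.

Lemma entry_sum (T I : finType) (A : I -> 'M[int]_#|T|) x y :
  entry (\sum_i A i) x y = \sum_i entry (A i) x y.
Proof. by rewrite /entry summxE. Qed.

(** * Maps to a chain as chains of sublevel sets *)

Section Levels.

Variables (Q : finType).

Definition below (k : nat) (f : {ffun Q -> 'I_k}) (i : nat) : {set Q} :=
  [set x | f x < i]%N.

Definition chain_map (E : rel {set Q}) (k : nat) (f : {ffun Q -> 'I_k}) : bool :=
  [forall i : 'I_k, E (below f i) (below f i.+1)].

(* The value [k] marks the points outside [I]. *)
Definition chain_maps_on (E : rel {set Q}) (k : nat) (I : {set Q}) :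
    {set {ffun Q -> 'I_k.+1}} :=
  [set f | (below f k == I) && [forall i : 'I_k, E (below f i) (below f i.+1)]].

(** The row index is the larger set, so powers descend from [I]. If [E] implies inclusion, the
    weights along any chain from [I] down to [set0] multiply to [c ^+ #|I|], so up to this factor a
    power counts chains. *)
Definition weighted_mx (c : int) (E : rel {set Q}) : 'M[int]_#|{set Q}| :=
  kernel_mx (fun I J => c ^+ #|I :\: J| *+ E J I).

Lemma card_chain_maps_on0 E I : #|chain_maps_on E 0 I| = (I == set0).
Proof.
have b0 (f : {ffun Q -> 'I_1}) : below f 0 = set0.
  by apply/setP => x; rewrite !inE ltn0.
case: eqP => [->|nI]; last first.
  by apply: eq_card0 => f; rewrite !inE b0 eq_sym (introF eqP nI).
rewrite (_ : chain_maps_on E 0 set0 = [set: _]).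
  by rewrite cardsT card_ffun card_ord exp1n.
by apply/setP => f; rewrite !inE b0 eqxx; apply/forallP => -[].
Qed.

(** Truncating the values at [k] is a bijection onto [chain_maps_on E k J]; the only condition it
    forgets is the last one, [E J I]. *)
Lemma card_chain_maps_on_step (E : rel {set Q}) k I J :
  (forall A B, E A B -> A \subset B) ->
  #|[set f in chain_maps_on E k.+1 I | below f k == J]|
  = (E J I * #|chain_maps_on E k J|)%N.
Proof.
move=> subE; case: (boolP (E J I)) => EJI; last first.
  apply: eq_card0 => f; rewrite !inE; apply/negP.
  case/andP=> /andP[/eqP fI /forallP Ef] /eqP fJ.
  by move: (Ef ord_max); rewrite /= fI fJ (negPf EJI).
rewrite mul1n.
(* The inverse of truncation: outside [J], points of [I] get the level [k] and all others the new
   marker [k.+1]. *)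
pose up (g : {ffun Q -> 'I_k.+1}) : {ffun Q -> 'I_k.+2} :=
  [ffun x => inord (if x \in J then nat_of_ord (g x) else if x \in I then k else k.+1)].
have upE g x : up g x = (if x \in J then nat_of_ord (g x) else if x \in I then k else k.+1) :> nat.
  by rewrite ffunE inordK //=; have := ltn_ord (g x); case: ifP => _; [|case: ifP => _]; lia.
have below_up g i : below g k = J -> (i <= k)%N -> below (up g) i = below g i.
  move=> gJ ik; apply/setP => x; rewrite !inE upE.
  case: ifP => // xJ; move: (xJ); rewrite -gJ inE; case: ifP => _; lia.
have below_upI g : below (up g) k.+1 = I.
  apply/setP => x; rewrite inE upE; case: ifP => xJ.
    by rewrite (ltn_ord (g x)) (subsetP (subE _ _ EJI)).
  by case: ifP => _; lia.
have -> : [set f in chain_maps_on E k.+1 I | below f k == J]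
          = up @: chain_maps_on E k J.
  apply/setP => f; apply/idP/imsetP.
    rewrite !inE => /andP[/andP[/eqP fI /forallP Ef] /eqP fJ].
    (* The level [k] and the marker [k.+1] of [f] merge into the marker [k] of [g]. *)
    pose g : {ffun Q -> 'I_k.+1} := [ffun x => inord (minn (f x) k)].
    have gE x : g x = minn (f x) k :> nat by rewrite ffunE inordK //; lia.
    have below_g i : (i <= k)%N -> below g i = below f i.
      by move=> ik; apply/setP => x; rewrite !inE gE; rewrite gtn_min [(k < i)%N]ltnNge ik orbF.
    have gf : f = up g.
      apply/ffunP => x; apply: ord_inj; rewrite /= upE -fJ -fI !inE gE.
      case: ltnP => // kf; case: ltnP => fk; apply/eqP; rewrite eqn_leq.
        by rewrite kf andbT -ltnS.
      by rewrite fk andbT -ltnS.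
    exists g => //; rewrite !inE below_g // fJ eqxx; apply/forallP => i.
    by rewrite !below_g //; [exact: (Ef (widen_ord (leqnSn _) i))|exact: ltnW].
  case=> g gC ->; have /[!inE]/andP[/eqP gJ /forallP Eg] := gC.
  rewrite below_upI eqxx below_up // gJ eqxx andbT /=.
  apply/forallP => i; have [ik|] := ltnP i k.
    by rewrite !below_up //; [exact: (Eg (Ordinal ik))|exact: ltnW].
  move=> ki; have -> : i = k :> nat by have := ltn_ord i; lia.
  by rewrite below_upI below_up // gJ.
rewrite card_in_imset // => g h; rewrite !inE.
move=> /andP[/eqP gJ _] /andP[/eqP hJ _] gh; apply/ffunP => x.
apply: ord_inj; move/(congr1 (fun u : {ffun Q -> 'I_k.+2} => val (u x))): gh.
rewrite /= !upE; case: ifP => // xJ _.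
(* Outside [J] both maps take the marker value [k]. *)
have: x \notin below g k by rewrite gJ xJ.
have: x \notin below h k by rewrite hJ xJ.
rewrite !inE -!leqNgt => kh kg; apply/eqP; rewrite eqn_leq.
by rewrite (leq_trans _ kg) ?(leq_trans _ kh) // -ltnS.
Qed.

(** Induction on [k]: the summation index of the first matrix product is the sublevel set
    [below f k]. *)
Lemma entry_weighted_mx_exp c (E : rel {set Q}) k (I : {set Q}) :
  (forall A B, E A B -> A \subset B) ->
  entry (weighted_mx c E ^+ k) I set0 = c ^+ #|I| *+ #|chain_maps_on E k I|.
Proof.
move=> subE; elim: k I => [|k IH] I.
  by rewrite expr0 entry1 card_chain_maps_on0; case: eqP => // ->; rewrite cards0.
have -> : #|chain_maps_on E k.+1 I| = (\sum_J E J I * #|chain_maps_on E k J|)%N.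
  rewrite -sum1_card (partition_big (fun f => below f k) xpredT) //=.
  apply: eq_bigr => J _; rewrite -card_chain_maps_on_step // -sum1_card.
  by apply: eq_bigl => f; rewrite inE.
rewrite exprS entryM -sumrMnr; apply: eq_bigr => J _.
rewrite entry_kernel IH; case: (boolP (E J I)) => [/subE JI|_]; last first.
  by rewrite mulr0n mul0r mul0n mulr0n.
rewrite mulr1n mul1n mulrnAr -exprD addnC; congr (_ ^+ _ *+ _).
by have := cardsID J I; rewrite (setIidPr JI).
Qed.

(** Each factor strictly shrinks the set, which can happen at most [#|I|] times. *)
Lemma entry_weighted_mx_exp_small c (E : rel {set Q}) k (I J : {set Q}) :
  (forall A B, E A B -> A \proper B) -> (#|I| < k)%N ->
  entry (weighted_mx c E ^+ k) I J = 0.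
Proof.
move=> propE; elim: k I => // k IH I Ik.
rewrite exprS entryM big1 // => K _; rewrite entry_kernel.
case: (boolP (E K I)) => [/propE/proper_card KI|_]; last by rewrite mulr0n mul0r.
by rewrite IH ?mulr0 //; lia.
Qed.

Lemma card_chain_maps_onT (E : rel {set Q}) k :
  #|chain_maps_on E k [set: Q]| = #|[set f : {ffun Q -> 'I_k} | chain_map E f]|.
Proof.
pose up (g : {ffun Q -> 'I_k}) : {ffun Q -> 'I_k.+1} :=
  [ffun x => widen_ord (leqnSn k) (g x)].
have below_up g i : below (up g) i = below g i.
  by apply/setP => x; rewrite !inE ffunE.
have -> : chain_maps_on E k [set: Q]
          = up @: [set f : {ffun Q -> 'I_k} | chain_map E f].
  apply/setP => f; rewrite inE; apply/andP/imsetP; last first.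
    case=> g; rewrite inE => /forallP Eg ->; split.
      by apply/eqP/setP => x; rewrite below_up !inE ltn_ord.
    by apply/forallP => i; rewrite !below_up.
  case=> /eqP/setP fT Ef.
  have fk x : (f x < k)%N by have := fT x; rewrite !inE.
  have fup : f = up [ffun x => Ordinal (fk x)].
    by apply/ffunP => x; apply: ord_inj; rewrite /= !ffunE.
  exists [ffun x => Ordinal (fk x)] => //; rewrite inE.
  by apply/forallP => i; have /forallP/(_ i) := Ef; rewrite [in X in X -> _]fup !below_up.
rewrite card_imset // => g h /ffunP gh; apply/ffunP => x; apply: ord_inj.
by have /(congr1 val) := gh x; rewrite !ffunE.
Qed.

End Levels.

(** * The zeta matrix of down-sets and its inverse *)

Section ZetaMatrix.

Variables (disp : Order.disp_t) (Q : finPOrderType disp).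
Implicit Types (I J K : {set Q}).

Definition lower_rel : rel {set Q} := fun J I =>
  (J \subset I) && [forall x in I, forall y in J, (x <= y)%O ==> (x \in J)].

(* For [J] lower in [I], this says that [I :\: J] is an antichain. *)
Definition antichain_rel : rel {set Q} := fun J I =>
  (J \subset I) && [forall x in I, forall y in I, (x < y)%O ==> (x \in J)].

Definition proper_lower_rel : rel {set Q} := fun J I =>
  lower_rel J I && (J != I).

Definition strict_map (k : nat) (f : {ffun Q -> 'I_k}) : bool :=
  [forall x, forall y, (x < y)%O ==> (f x < f y)%N].

Lemma lowerP J I :
  reflect (J \subset I /\ forall x y, x \in I -> y \in J -> (x <= y)%O -> x \in J)
          (lower_rel J I).
Proof.
apply: (iffP andP) => -[JI H]; split=> //.
  by move=> x y xI yJ xy; move/forall_inP/(_ x xI)/forall_inP/(_ y yJ)/implyP: H; exact.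
apply/forall_inP => x xI; apply/forall_inP => y yJ; apply/implyP; exact: H.
Qed.

Lemma antichainP J I :
  reflect (J \subset I /\ forall x y, x \in I -> y \in I -> (x < y)%O -> x \in J)
          (antichain_rel J I).
Proof.
apply: (iffP andP) => -[JI H]; split=> //.
  by move=> x y xI yI xy; move/forall_inP/(_ x xI)/forall_inP/(_ y yI)/implyP: H; exact.
apply/forall_inP => x xI; apply/forall_inP => y yJ; apply/implyP; exact: H.
Qed.

Lemma lower_sub J I : lower_rel J I -> J \subset I.
Proof. by case/andP. Qed.

Lemma antichain_sub J I : antichain_rel J I -> J \subset I.
Proof. by case/andP. Qed.

Lemma proper_lower_proper J I : proper_lower_rel J I -> J \proper I.
Proof. by case/andP=> /lower_sub JI neq; rewrite properEneq neq. Qed.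

Lemma lower_refl I : lower_rel I I.
Proof. by apply/lowerP. Qed.

Lemma antichain_refl I : antichain_rel I I.
Proof. by apply/antichainP. Qed.

Lemma antichain_lower J I : antichain_rel J I -> lower_rel J I.
Proof.
move=> /antichainP[JI H]; apply/lowerP; split=> // x y xI yJ.
by rewrite le_eqVlt => /orP[/eqP-> //|]; apply: H => //; exact: (subsetP JI).
Qed.

Lemma lower_trans J K I : lower_rel J K -> lower_rel K I -> lower_rel J I.
Proof.
move=> /lowerP[JK HJ] /lowerP[KI HK]; apply/lowerP; split.
  exact: subset_trans KI.
move=> x y xI yJ xy; apply: (HJ x y) => //.
by apply: (HK x y) => //; exact: (subsetP JK).
Qed.

Lemma lower_between J K I :
  lower_rel J I -> K \subset I -> lower_rel J K = (J \subset K).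
Proof.
move=> /lowerP[_ HJ] KI; apply/idP/idP => [/lower_sub//|JK].
by apply/lowerP; split=> // x y /(subsetP KI); exact: HJ.
Qed.

Definition zeta_mx := weighted_mx 1 lower_rel.
Definition mobius_mx := weighted_mx (-1) antichain_rel.

Lemma exists_maximal (A : {set Q}) :
  A != set0 -> exists2 z, z \in A & forall y, y \in A -> ~~ (z < y)%O.
Proof.
case/set0Pn=> x0 x0A.
(* Choose [z] with the most elements strictly below it: anything above [z] would have all of these
   below it, and [z] as well. *)
case: (@arg_maxnP _ x0 (mem A) (fun z => #|[set t | (t < z)%O]|) x0A) => z zA zmax.
exists z => // y yA; apply/negP => zy.
have := zmax y yA; rewrite /= leqNgt => /negP; apply; apply: proper_card.
apply/properP; split; last by exists z; rewrite !inE ?ltxx.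
by apply/subsetP => t; rewrite !inE => /lt_trans; apply.
Qed.

Definition toggle (z : Q) K := if z \in K then K :\ z else z |: K.

Lemma toggleK z : involutive (toggle z).
Proof.
move=> K; rewrite /toggle; case: (boolP (z \in K)) => zK.
  by rewrite !inE eqxx setD1K.
by rewrite !inE eqxx setU1K.
Qed.

Lemma in_toggle z K x : x != z -> (x \in toggle z K) = (x \in K).
Proof. by move=> xz; rewrite /toggle; case: ifP => _; rewrite !inE (negPf xz). Qed.

Lemma toggle_sub z K I : z \in I -> (toggle z K \subset I) = (K \subset I).
Proof.
move=> zI; apply/subsetP/subsetP => H x xK; have [->//|xz] := eqVneq x z.
  by apply: H; rewrite in_toggle.
by apply: H; rewrite -(in_toggle K xz).
Qed.

(** Off the diagonal, a sign-reversing involution cancels the sum over the intermediate sets [K]: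
    toggle in [K] a fixed maximal element [z] of [I :\: J]. *)
Lemma mobius_zeta : mobius_mx * zeta_mx = 1.
Proof.
apply: entry_inj => I J; rewrite entryM entry1.
under eq_bigr do rewrite !entry_kernel expr1n.
have [<-|nIJ] := eqVneq I J.
  rewrite (bigD1 I) //= lower_refl antichain_refl setDv cards0 big1 ?addr0 // => K nKI.
  case: (boolP (antichain_rel K I)) => [/antichain_sub KI|_]; last by rewrite mul0r.
  case: (boolP (lower_rel I K)) => [/lower_sub IK|_]; last by rewrite mulr0.
  by rewrite eqEsubset KI IK in nKI.
have [JI|nJI] := boolP (lower_rel J I); last first.
  rewrite big1 // => K _; case: (boolP (antichain_rel K I)) => [KI|_]; last by rewrite mul0r.
  case: (boolP (lower_rel J K)) => [JK|_]; last by rewrite mulr0.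
  by case/negP: nJI; apply: lower_trans JK (antichain_lower KI).
have [|z] := @exists_maximal (I :\: J).
  by rewrite setD_eq0; apply: contra nIJ => IJ; rewrite eqEsubset IJ (lower_sub JI).
rewrite inE => /andP[zJ zI] zmax.
(* [z] is maximal even in [I]: an element of [J] above [z] would force [z] into the down-set [J]. *)
have zmaxI y : y \in I -> ~~ (z < y)%O.
  move=> yI; case: (boolP (y \in J)) => yJ; last by apply: zmax; rewrite inE yJ.
  apply: contra zJ => /ltW zy; by case/lowerP: JI => _ /(_ z y zI yJ zy).
pose F K : int := (-1) ^+ #|I :\: K| *+ antichain_rel K I * (1 *+ lower_rel J K).
have FN K : F (toggle z K) = - F K.
  (* The antichain condition only puts into [K] elements lying below another element of [I], and [z]
     is not one of them. *)
  have EK : antichain_rel (toggle z K) I = antichain_rel K I.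
    apply/antichainP/antichainP => -[KI H]; split.
    - by rewrite -(toggle_sub K zI).
    - move=> x y xI yI xy; have xz : x != z.
        by apply: contraTneq xy => ->; exact: zmaxI.
      by rewrite -(in_toggle K xz); exact: (H x y).
    - by rewrite toggle_sub.
    - move=> x y xI yI xy; have xz : x != z.
        by apply: contraTneq xy => ->; exact: zmaxI.
      by rewrite in_toggle //; exact: (H x y).
  rewrite /F EK; case: (boolP (antichain_rel K I)) => KI; last by rewrite !mul0r oppr0.
  have KI' := antichain_sub KI.
  rewrite !(lower_between JI) // ?toggle_sub //.
  have -> : (J \subset toggle z K) = (J \subset K).
    apply/subsetP/subsetP => H x xJ; have xz : x != z.
    - by apply: contraNneq zJ => <-.
    - by rewrite -(in_toggle K xz); exact: H.
    - by apply: contraNneq zJ => <-.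
    - by rewrite in_toggle //; exact: H.
  rewrite -mulNr; congr (_ * _); rewrite !mulr1n.
  rewrite /toggle; case: (boolP (z \in K)) => zK.
    have -> : I :\: (K :\ z) = z |: (I :\: K).
      apply/setP => x; rewrite !inE; have [->|] := eqVneq x z; first by rewrite zI.
      by [].
    by rewrite cardsU1 !inE zK /= exprS mulN1r.
  rewrite [in RHS](cardsD1 z (I :\: K)) !inE zI zK /= exprS mulN1r opprK.
  by congr (_ ^+ #|pred_of_set _|); apply/setP => x; rewrite !inE; case: eqVneq.
have S : \sum_K F K = - \sum_K F K.
  rewrite [LHS](reindex_inj (inv_inj (@toggleK z))) -sumrN.
  by apply: eq_bigr => K _; exact: FN.
by rewrite -[LHS]/(\sum_K F K); move: S; move: (\sum_K F K) => t; rewrite ?mulr0n; lia.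
Qed.

Lemma zeta_sub1 : zeta_mx - 1 = weighted_mx 1 proper_lower_rel.
Proof.
apply: entry_inj => I J; rewrite entryB entry1 !entry_kernel !expr1n /proper_lower_rel.
rewrite eq_sym; have [->|_] := eqVneq J I; first by rewrite lower_refl subrr.
by rewrite subr0 andbT.
Qed.

Lemma chain_map_lower k (f : {ffun Q -> 'I_k}) :
  chain_map lower_rel f = order_preserving f.
Proof.
apply/forallP/forallP => H.
  move=> x; apply/forallP => y; apply/implyP => xy; rewrite leEord leqNgt; apply/negP => yx.
  (* The level [f x] is the one where [x] is still missing but [y] is already present, contradicting
     that the sublevel set is a down-set. *)
  have /lowerP[_ /(_ x y)] := H (f x).
  by rewrite !inE ltnS leqnn ltnn => /(_ isT yx xy).
move=> i; apply/lowerP; split; first by apply/subsetP => x; rewrite !inE; exact: leqW.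
move=> x y _; rewrite !inE => yi xy; apply: leq_ltn_trans yi.
by have /forallP/(_ y)/implyP/(_ xy) := H x.
Qed.

Lemma chain_map_antichain k (f : {ffun Q -> 'I_k}) :
  chain_map antichain_rel f = strict_map f.
Proof.
apply/forallP/forallP => H.
  move=> x; apply/forallP => y; apply/implyP => xy; rewrite ltnNge; apply/negP => yx.
  have /antichainP[_ /(_ x y)] := H (f x).
  by rewrite !inE !ltnS leqnn ltnn => /(_ isT yx xy).
move=> i; apply/antichainP; split; first by apply/subsetP => x; rewrite !inE; exact: leqW.
move=> x y _; rewrite !inE ltnS => yi xy; apply: leq_trans yi.
by have /forallP/(_ y)/implyP/(_ xy) := H x.
Qed.

(** Properness of each inclusion means that every level is attained; a surjection between sets of
    the same size is injective. *)
Lemma chain_map_proper_lower (f : {ffun Q -> 'I_#|Q|}) :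
  chain_map proper_lower_rel f = (f \in linear_extensions Q).
Proof.
rewrite inE -chain_map_lower; apply/forallP/and3P => [H|[_ /forallP sf /forallP H] i].
  have sf : forall i, exists x, f x == i.
    move=> i; have /proper_lower_proper/properP[_ [x]] := H i.
    rewrite !inE ltnS -leqNgt => fi iF; exists x.
    by rewrite -val_eqE eqn_leq fi.
  split.
  - apply/injectiveP; apply: in2T; apply/image_injP/eqP; rewrite -[RHS]card_ord.
    by apply: eq_card => i; have [x /eqP <-] := sf i; rewrite inE image_f.
  - by apply/forallP => i; apply/existsP.
  - by apply/forallP => i; case/andP: (H i).
rewrite /proper_lower_rel H /=; have /existsP[x /eqP fx] := sf i.
by apply/eqP => /setP/(_ x); rewrite !inE fx ltnn ltnS leqnn.
Qed.

Lemma zeta_mx_exp k : entry (zeta_mx ^+ k) [set: Q] set0 = (order_polynomial Q k)%:Z.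
Proof.
rewrite entry_weighted_mx_exp; last exact: lower_sub.
rewrite expr1n card_chain_maps_onT natz; congr (Posz #|pred_of_set _|).
by apply/setP => f; rewrite !inE chain_map_lower.
Qed.

Lemma mobius_mx_exp k :
  entry (mobius_mx ^+ k) [set: Q] set0
  = (-1) ^+ #|Q| * #|[set f : {ffun Q -> 'I_k} | strict_map f]|%:Z.
Proof.
rewrite entry_weighted_mx_exp; last exact: antichain_sub.
rewrite cardsT card_chain_maps_onT -mulr_natr natz; congr (_ * Posz #|pred_of_set _|).
by apply/setP => f; rewrite !inE chain_map_antichain.
Qed.

Lemma zeta_sub1_exp_card :
  entry ((zeta_mx - 1) ^+ #|Q|) [set: Q] set0 = (num_linear_extensions Q)%:Z.
Proof.
rewrite zeta_sub1 entry_weighted_mx_exp => [|J I]; last by case/andP=> /lower_sub.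
rewrite expr1n card_chain_maps_onT natz; congr (Posz #|pred_of_set _|).
by apply/setP => f; rewrite inE chain_map_proper_lower.
Qed.

Lemma zeta_sub1_nilpotent : (zeta_mx - 1) ^+ #|Q|.+1 = 0.
Proof.
apply: entry_inj => I J; rewrite zeta_sub1 entry_weighted_mx_exp_small.
- by rewrite /entry mxE.
- exact: proper_lower_proper.
- by rewrite ltnS max_card.
Qed.

End ZetaMatrix.

(** * Rank function and strict maps of a graded poset *)

Section Graded.

Variables (disp : Order.disp_t) (Q : finPOrderType disp) (r : nat).
Hypothesis Q_graded : graded_of_rank Q r.
Implicit Types (x y z : Q) (A B : {set Q}).

Local Notation maxchain := (maxset (@is_chain disp Q)).

Lemma chainP (A : {set Q}) :
  reflect {in A &, forall x y, (x >=< y)%O} (is_chain A).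
Proof.
apply: (iffP forall_inP) => H x; last by move=> xA; apply/forall_inP => y; exact: H.
by move=> y xA yA; have /forall_inP := H x xA; exact.
Qed.

(** The point [x] itself is counted in the upper part only, so that the two parts split a chain
    through [x] and the lower one has as many elements as the rank of [x]. *)
Definition lower_part (A : {set Q}) x := [set z in A | (z < x)%O].
Definition upper_part (A : {set Q}) x := [set z in A | (x <= z)%O].

(** The member [x] makes the chain non-empty, so the truncated predecessor in [chain_length] can be
    undone. *)
Lemma card_maxchain_pos A x : maxchain A -> x \in A -> #|A| = r.+1.
Proof.
move=> mA xA; have := Q_graded mA; rewrite /chain_length => <-.
by rewrite prednK //; apply/card_gt0P; exists x.
Qed.

Lemma card_parts A x : is_chain A -> x \in A ->
  (#|lower_part A x| + #|upper_part A x|)%N = #|A|.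
Proof.
move=> /chainP cA xA; rewrite -(cardsID [set z | (z < x)%O] A).
congr (_ + _)%N; apply: eq_card => z; rewrite !inE //.
by case zA: (z \in A); rewrite /= ?andbF // andbT -comparable_leNgt ?cA.
Qed.

Lemma maxchain_exists (A : {set Q}) :
  is_chain A -> exists2 B, maxchain B & A \subset B.
Proof. by move=> cA; have [B mB AB] := maxset_exists cA; exists B. Qed.

(* Splicing the part of [A] below [x] with the part of [B] above [x] gives a
   chain, and no chain has more than [r.+1] elements. *)
Lemma card_lower_part_le A B x : maxchain A -> maxchain B -> x \in A -> x \in B ->
  (#|lower_part A x| <= #|lower_part B x|)%N.
Proof.
move=> mA mB xA xB; have cA := chainP _ (maxsetp mA); have cB := chainP _ (maxsetp mB).
have cU : is_chain (lower_part A x :|: upper_part B x).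
  apply/chainP => y z; rewrite !inE.
  case/orP=> /andP[yM yx] /orP[] /andP[zM zx].
  - exact: cA.
  - by apply: le_comparable; apply: le_trans zx; exact: ltW.
  - by apply: ge_comparable; apply: le_trans yx; exact: ltW.
  - exact: cB.
have [C mC UC] := maxchain_exists cU.
have xC : x \in C by apply: (subsetP UC); rewrite !inE xB lexx orbT.
rewrite -(leq_add2r #|upper_part B x|) card_parts ?(maxsetp mB) //.
rewrite (card_maxchain_pos mB xB) -(card_maxchain_pos mC xC).
apply: leq_trans (subset_leq_card UC); rewrite cardsU.
rewrite (_ : _ :&: _ = set0) ?cards0 ?subn0 //.
apply/setP => z; rewrite !inE; apply/negP => /andP[/andP[_ zx] /andP[_]].
by rewrite (lt_geF zx).
Qed.

Lemma chain1 x : is_chain [set x].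
Proof. by apply/chainP => y z /set1P-> /set1P->; exact: comparablexx. Qed.

Lemma chain2 x y : (x <= y)%O -> is_chain [set x; y].
Proof.
move=> xy; apply/chainP => u v /set2P[]-> /set2P[]->.
all: by [exact: comparablexx|exact: le_comparable|exact: ge_comparable].
Qed.

(** The default [0] is never reached, since every point lies on a maximal chain; by [rankE] the
    chain picked does not matter. *)
Definition rank x : nat :=
  odflt 0%N (omap (fun A => #|lower_part A x|) [pick A | maxchain A && (x \in A)]).

Lemma rankE A x : maxchain A -> x \in A -> rank x = #|lower_part A x|.
Proof.
move=> mA xA; rewrite /rank; case: pickP => [B /andP[mB xB]|/(_ A)]; last first.
  by rewrite mA xA.
by apply/eqP; rewrite eqn_leq !card_lower_part_le.
Qed.

Lemma maxchain_of x : exists2 A, maxchain A & x \in A.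
Proof.
by have [A mA] := maxchain_exists (chain1 x); rewrite sub1set; exists A.
Qed.

Lemma maxchain_of2 x y : (x <= y)%O -> exists A, [/\ maxchain A, x \in A & y \in A].
Proof.
move=> /chain2 /maxchain_exists[A mA]; rewrite subUset !sub1set => /andP[xA yA].
by exists A.
Qed.

Lemma rank_le x : (rank x <= r)%N.
Proof.
have [A mA xA] := maxchain_of x; rewrite (rankE mA xA) -ltnS -(card_maxchain_pos mA xA).
apply: proper_card; apply/properP; split; last by exists x; rewrite // inE ltxx andbF.
by apply/subsetP => z; rewrite inE => /andP[].
Qed.

Lemma rank_lt x y : (x < y)%O -> (rank x < rank y)%N.
Proof.
move=> xy; have [A [mA xA yA]] := maxchain_of2 (ltW xy).
rewrite (rankE mA xA) (rankE mA yA); apply: proper_card; apply/properP; split.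
  by apply/subsetP => z; rewrite !inE => /andP[-> /lt_trans]; exact.
by exists x; rewrite !inE ?ltxx ?andbF // xA.
Qed.

(** A strictly increasing function is injective on a chain, and the interval from [a] to [b], with
    [b] excluded, has [b - a] values. *)
Lemma card_chain_le (f : Q -> nat) (A : {set Q}) a b :
  is_chain A -> {homo f : x y / (x < y)%O >-> (x < y)%N} ->
  {in A, forall x, a <= f x < b}%N -> (#|A| <= b - a)%N.
Proof.
move=> /chainP cA fS fA; rewrite cardE -(size_map f) -(size_iota a (b - a)).
apply: uniq_leq_size.
  rewrite map_inj_in_uniq ?enum_uniq // => x y; rewrite !mem_enum => xA yA fxy.
  apply/eqP; case: comparableP (cA x y xA yA) => // /fS; by rewrite fxy ltnn.
move=> t /mapP[x]; rewrite mem_enum mem_iota => xA ->.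
by have := fA x xA; lia.
Qed.

Section StrictMap.

Variables (k : nat) (f : Q -> nat).
Hypothesis f_lt : {homo f : x y / (x < y)%O >-> (x < y)%N}.

Lemma chainS (A B : {set Q}) : is_chain A -> B \subset A -> is_chain B.
Proof. by move=> /chainP cA /subsetP BA; apply/chainP => x y /BA xA /BA; exact: cA. Qed.

(** The [rank x] elements below [x] on a maximal chain have distinct values smaller than [f x]. *)
Lemma rank_le_strict x : (rank x <= f x)%N.
Proof.
have [A mA xA] := maxchain_of x; rewrite (rankE mA xA) -[leqRHS]subn0.
apply: card_chain_le f_lt _; last by move=> z; rewrite inE => /andP[_ /f_lt].
by apply: chainS (maxsetp mA) _; apply/subsetP => z; rewrite inE => /andP[].
Qed.

(** On a maximal chain through [x], the [r.+1 - rank x] elements from [x] upwards have distinct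
    values from [f x] to [k + r - 1]. *)
Lemma strict_le_rank x : (forall y, f y < k + r)%N -> (f x - rank x < k)%N.
Proof.
move=> fk; have [A mA xA] := maxchain_of x.
have : (#|upper_part A x| <= k + r - f x)%N.
  apply: card_chain_le f_lt _; last first.
    by move=> z; rewrite inE fk andbT le_eqVlt => /andP[_ /orP[/eqP->|/f_lt/ltnW]].
  by apply: chainS (maxsetp mA) _; apply/subsetP => z; rewrite inE => /andP[].
have := card_parts (maxsetp mA) xA; rewrite (card_maxchain_pos mA xA) -(rankE mA xA).
by have := rank_le_strict x; have := rank_le x; have := fk x; lia.
Qed.

(** On a maximal chain through both points, the [rank y - rank x] elements from [x] to just before
    [y] have distinct values in the [f y - f x] places from [f x] on. *)
Lemma strict_sub_rank x y : (x <= y)%O -> (f x - rank x <= f y - rank y)%N.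
Proof.
move=> xy; have [A [mA xA yA]] := maxchain_of2 xy.
have : (#|lower_part A y :\: lower_part A x| <= f y - f x)%N.
  apply: card_chain_le f_lt _.
    by apply: chainS (maxsetp mA) _; apply/subsetP => z; rewrite !inE => /and3P[].
  move=> z; rewrite !inE => /and3P[+ zA zy]; rewrite zA /= (f_lt zy) andbT => xz.
  have : (x <= z)%O by rewrite comparable_leNgt //; exact: (chainP _ (maxsetp mA)).
  by rewrite le_eqVlt => /orP[/eqP->|/f_lt/ltnW].
rewrite cardsD (setIidPr _) -?(rankE mA) //; last first.
  by apply/subsetP => z; rewrite !inE => /andP[-> /lt_le_trans]; exact.
have := rank_le_strict x; have := rank_le_strict y.
move: xy; rewrite le_eqVlt => /orP[/eqP->//|xy].
by have := f_lt xy; lia.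
Qed.

End StrictMap.

(** Adding [rank] is inverted by subtracting it: [rank_le_strict] rules out truncation,
    [strict_le_rank] gives values below [k], and [strict_sub_rank] gives monotonicity. *)
Lemma card_strict_maps k : (0 < k)%N ->
  #|[set f : {ffun Q -> 'I_(k + r)} | strict_map f]| = order_polynomial Q k.
Proof.
move=> k0.
have lt_shift (g : {ffun Q -> 'I_k}) x : (g x + rank x < k + r)%N.
  by have := rank_le x; have := ltn_ord (g x); lia.
pose shift (g : {ffun Q -> 'I_k}) : {ffun Q -> 'I_(k + r)} :=
  [ffun x => Ordinal (lt_shift g x)].
have shiftE g x : shift g x = (g x + rank x)%N :> nat by rewrite ffunE.
rewrite /order_polynomial -(card_imset _ (_ : injective shift)); last first.
  move=> g h /ffunP gh; apply/ffunP => x; apply: ord_inj.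
  by have /(congr1 (@nat_of_ord _)) := gh x; rewrite !shiftE => /addIn.
apply: eq_card => f; rewrite inE; apply/idP/imsetP => [sf|[g]].
  have f_lt : {homo (fun x => nat_of_ord (f x)) : x y / (x < y)%O >-> (x < y)%N}.
    by move=> x y; have /forallP/(_ x)/forallP/(_ y)/implyP := sf.
  have fk := strict_le_rank f_lt _ (fun y => ltn_ord (f y)).
  exists [ffun x => Ordinal (fk x)].
    rewrite inE; apply/forallP => x; apply/forallP => y; apply/implyP => xy.
    by rewrite !ffunE leEord; exact: strict_sub_rank f_lt _ _ xy.
  by apply/ffunP => x; apply: ord_inj; rewrite shiftE ffunE /= subnK //; exact: (rank_le_strict f_lt x).
rewrite inE => og ->; apply/forallP => x; apply/forallP => y; apply/implyP => xy.
have /forallP/(_ x)/forallP/(_ y)/implyP/(_ (ltW xy)) := og; rewrite leEord.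
by rewrite !shiftE; have := rank_lt xy; lia.
Qed.

End Graded.

(** * Folding the binomial expansion *)

Theorem corollary5p11 (disp : Order.disp_t) (Q : finPOrderType disp)
    (r d : nat) (Q_nonempty : (0 < #|Q|)%N) (Q_graded : graded_of_rank Q r)
    (card_Q : #|Q| = d) :
  let n := d./2 in
  ((r + 2) ^ d * num_linear_extensions Q)%N%:Z =
  \sum_(0 <= m < n.+1)
     (-1) ^+ (n + m) *
     ('C(d, n - m)%:Z + (-1) ^+ (d - 1) * 'C(d, n + m + 1)%:Z) *
     (order_polynomial Q (m * (r + 2) + 1))%:Z.
Proof.
move=> n; set s := (r + 2)%N.
set Z := zeta_mx Q; set M := mobius_mx Q.
have MZ : M * Z = 1 by exact: mobius_zeta.
have MZk a k : M ^+ (a + k) * Z ^+ k = M ^+ a.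
  elim: k => [|k IH]; first by rewrite addn0 mulr1.
  by rewrite addnS exprSr exprS mulrA -[_ * M * Z]mulrA MZ mulr1 IH.
have MZk' a k : M ^+ a * Z ^+ (a + k) = Z ^+ k.
  elim: a => [|a IH]; first by rewrite mul1r.
  by rewrite exprSr addSn exprS mulrA -[_ * M * Z]mulrA MZ mulr1 IH.
have n2 : (n + n <= d <= n + n + 1)%N.
  by rewrite -[d]odd_double_half -/n -addnn; case: (odd d); lia.
(* The net exponent of [Z] is [(j - (d - n)) * s + 1]. If it is negative, its absolute value is
   [k + r] with [k = (d - n - 1 - j) * s + 1], because [s - 1 = r + 1]; this is where strict maps
   become order-preserving ones. *)
have W j : (j <= d)%N -> entry (M ^+ ((d - n) * s) * Z ^+ (j * s + 1)) [set: Q] set0 =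
    if (d - n <= j)%N then (order_polynomial Q ((j - (d - n)) * s + 1))%:Z
    else (-1) ^+ d * (order_polynomial Q ((d - n - 1 - j) * s + 1))%:Z.
  move=> jd; case: leqP => jn.
    have -> : (j * s + 1 = (d - n) * s + ((j - (d - n)) * s + 1))%N.
      by rewrite addnA -mulnDl subnKC.
    by rewrite MZk' zeta_mx_exp.
  have -> : ((d - n) * s = ((d - n - 1 - j) * s + 1 + r) + (j * s + 1))%N.
    have -> : (d - n = (d - n - 1 - j) + j + 1)%N by lia.
    have -> : ((d - n - 1 - j + j + 1) - 1 - j = d - n - 1 - j)%N by lia.
    by rewrite /s; lia.
  by rewrite MZk mobius_mx_exp card_Q card_strict_maps // addn1.
have N0 : (Z - 1) ^+ d.+1 = 0 by rewrite -card_Q zeta_sub1_nilpotent.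
have := mul_finite_difference ((d - n) * s) s MZ N0.
move/(congr1 (fun A => entry A [set: Q] set0)).
rewrite entryMn -{3}card_Q zeta_sub1_exp_card -mulr_natl natz -PoszM => <-.
rewrite exprBn_comm; last exact: commr1.
rewrite mulr_sumr mulr_suml entry_sum.
have E (i : 'I_d.+1) : entry (M ^+ ((d - n) * s) *
     ((-1) ^+ i * (Z ^+ s) ^+ (d - i) * 1 ^+ i *+ 'C(d, i)) * Z) [set: Q] set0 =
   (-1) ^+ i * 'C(d, i)%:Z *
    entry (M ^+ ((d - n) * s) * Z ^+ ((d - i) * s + 1)) [set: Q] set0.
  rewrite expr1n mulr1 -exprM mulrnAr mulrnAl entryMn -mulr_natr natz [in RHS]mulrAC.
  congr (_ * _).
  (* One sign is a power of the matrix [-1] and the other an integer; by parity each is [1] or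
     [-1]. *)
  rewrite -signr_odd -[in RHS]signr_odd addn1 exprSr [(s * _)%N]mulnC !mulrA.
  case: (odd i); last by rewrite !expr0 mul1r mulr1.
  by rewrite !expr1 mulN1r mulrN1 !mulNr /entry mxE.
rewrite (eq_bigr _ (fun i _ => E i)).
(* The substitution [j = d - i] turns the condition [d - n <= j] into [i <= n]. *)
pose G i : int := (-1) ^+ i * 'C(d, i)%:Z *
  (if (i <= n)%N then (order_polynomial Q ((n - i) * s + 1))%:Z
   else (-1) ^+ d * (order_polynomial Q ((i - n.+1) * s + 1))%:Z).
have -> : \sum_(i < d.+1) (-1) ^+ i * 'C(d, i)%:Z *
    entry (M ^+ ((d - n) * s) * Z ^+ ((d - i) * s + 1)) [set: Q] set0
  = \sum_(i < d.+1) G i.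
  apply: eq_bigr => i _; have id := ltn_ord i; rewrite W ?leq_subr // /G.
  have -> : (d - n <= d - i)%N = (i <= n)%N by apply/idP/idP; lia.
  by case: leqP => ni; do ?congr (_ * _); congr (Posz (order_polynomial Q (_ * s + 1))); lia.
(* For even [d] this adds the single index [d.+1], whose binomial coefficient is zero; for odd [d]
   it adds nothing. The range then has two halves of equal length. *)
have -> : \sum_(i < d.+1) G i = \sum_(i < n.+1 + n.+1) G i.
  rewrite (big_ord_widen (n.+1 + n.+1) G) ?big_mkcond; last by lia.
  apply: eq_bigr => i _; case: ltnP => // di.
  by rewrite /G bin_small // mulr0 mul0r.
(* Reversing the first half pairs [i = n - m] with [i = n + m + 1]; both carry the argument
   [m * s + 1]. *)
rewrite big_split_ord /= (reindex_inj rev_ord_inj) -big_split /= big_mkord.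
apply: eq_bigr => m _; have mn := ltn_ord m; rewrite /G.
have -> : (n.+1 - m.+1 = n - m)%N by lia.
rewrite leq_subr subKn // [(n.+1 + m <= n)%N]leqNgt ltnS leq_addr /=.
have -> : (-1) ^+ (n - m) = (-1) ^+ (n + m) :> int.
  by rewrite -signr_odd -[in RHS]signr_odd oddB // oddD.
(* Non-emptiness makes [d - 1] a true predecessor; the minus sign cancels the one from the odd shift
   in [n + m + 1]. *)
have -> : (-1) ^+ d = - (-1) ^+ (d - 1) :> int.
  by rewrite -[in LHS](@subnK 1 d) -?card_Q // exprD expr1 mulrN1.
by rewrite addKn addSn [(n + m + 1)%N]addn1 exprS; ring.
Qed.
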